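(* Let $\pi_\theta$ be a tabular policy, $\mathcal{S} \subseteq \mathcal{X}$ a set of training prompts, $r_{\mathrm{G}} : \mathcal{X} \times \mathcal{Y} \to [-1,1]$ the ground truth reward, $\mathbf{x} \in \mathcal{S}$ a prompt and $\pi_{\theta(0)}$ any initial policy. Let $\gamma > 0$ and let $\mathbf{y}^\gamma \in \mathcal{Y}$ be an output satisfying $r_{\mathrm{G}}(\mathbf{x},\mathbf{y}^\gamma) > \mathbb{E}_{\mathbf{y} \sim \pi_{\theta(0)}(\cdot|\mathbf{x})}[r_{\mathrm{G}}(\mathbf{x},\mathbf{y})] + \gamma$. When gradient flow is used to maximize the RLHF objective over $\mathcal{S}$ (with respect to a given reward model), denote by $t_\gamma$ the initial (first) time $t\ge 0$ at which $\mathbb{E}_{\mathbf{y} \sim \pi_{\theta(t)}(\cdot|\mathbf{x})}[r_{\mathrm{G}}(\mathbf{x},\mathbf{y})] \ge \mathbb{E}_{\mathbf{y} \sim \pi_{\theta(0)}(\cdot|\mathbf{x})}[r_{\mathrm{G}}(\mathbf{x},\mathbf{y})] + \gamma$ (with $t_\gamma = \infty$ if no such time exists). Then, for any $T \ge 1$, any distribution $\mathcal{D}$ over unordered output pairs, any attainable accuracy $\alpha \in [0,1]$, and any attainable accuracy subject to $\mathbf{y}^\gamma$ being ranked first $\alpha' \in [0,1]$ (both for $\mathbf{x}$, $\mathcal{D}$, $r_{\mathrm{G}}$), there exist reward models $r_{\mathrm{RM}}, r'_{\mathrm{RM}} : \mathcal{X} \times \mathcal{Y} \to [-1,1]$ with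 $\mathrm{acc}_{\mathbf{x},\mathcal{D}}(r_{\mathrm{RM}}) = \alpha$ and $\mathrm{acc}_{\mathbf{x},\mathcal{D}}(r'_{\mathrm{RM}}) = \alpha'$ such that the following hold. (1) When using $r_{\mathrm{RM}}$ for maximizing the RLHF objective (with KL coefficient $\lambda \ge 0$), $$t_\gamma \ge 2|\mathcal{S}|\left(1 - \exp\left(-\frac{\gamma}{2}\right)\right)\cdot T = \Omega(T).$$ (2) If the KL coefficient $\lambda \ge 0$ satisfies $$\lambda \le \frac{\pi_{\theta(0)}(\mathbf{y}^\gamma|\mathbf{x})(1-\rho)^4}{8\left(\frac{1}{2e} - 2\ln \min_{\mathbf{y} \in \mathcal{Y}} \pi_{\theta(0)}(\mathbf{y}|\mathbf{x})\right)},$$ then when using $r'_{\mathrm{RM}}$ for maximizing the RLHF objective, $$t_\gamma \le \frac{4|\mathcal{S}|}{(1-\rho)^4}\cdot\left(\frac{1}{\pi_{\theta(0)}(\mathbf{y}^\gamma|\mathbf{x})} - \frac{1}{\rho}\right) = O\left(\frac{1}{\pi_{\theta(0)}(\mathbf{y}^\gamma|\mathbf{x})}\right),$$ where $$\rho := \frac{\mathbb{E}_{\mathbf{y} \sim \pi_{\theta(0)}(\cdot|\mathbf{x})}[r_{\mathrm{G}}(\mathbf{x},\mathbf{y})] + \gamma + 1}{r_{\mathrm{G}}(\mathbf{x},\mathbf{y}^\gamma) + 1} \in (0,1).$$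
   Context: Setting. $\mathcal{X}$ (prompts) and $\mathcal{Y}$ (outputs) are finite sets and $\mathcal{S}\subseteq\mathcal{X}$ is nonempty. Tabular policy: for $\theta \in \mathbb{R}^{|\mathcal{Y}|\times|\mathcal{X}|}$, $\pi_\theta(\mathbf{y}|\mathbf{x}) = \mathrm{softmax}(\theta_{:,\mathbf{x}})_{\mathbf{y}} = \exp(\theta_{\mathbf{y},\mathbf{x}})/\sum_{\mathbf{y}'\in\mathcal{Y}}\exp(\theta_{\mathbf{y}',\mathbf{x}})$, where $\theta_{:,\mathbf{x}}$ is the column of $\theta$ corresponding to $\mathbf{x}$. RLHF objective with respect to a reward model $r_{\mathrm{RM}}:\mathcal{X}\times\mathcal{Y}\to[-1,1]$ and KL coefficient $\lambda\ge0$: $$\phi_{\mathrm{RLHF}}(\theta) := \mathbb{E}_{\mathbf{x}\sim\mathcal{S}}\Big[\mathbb{E}_{\mathbf{y}\sim\pi_\theta(\cdot|\mathbf{x})}[r_{\mathrm{RM}}(\mathbf{x},\mathbf{y})] - \lambda\cdot\mathrm{KL}\big(\pi_\theta(\cdot|\mathbf{x})\,\|\,\pi_{\theta_{\mathrm{ref}}}(\cdot|\mathbf{x})\big)\Big],$$ with $\mathbf{x}\sim\mathcal{S}$ uniform. Gradient flow: $\frac{d}{dt}\theta(t)=\nabla\phi_{\mathrm{RLHF}}(\theta(t))$, $t\ge0$, with $\theta(0)=\theta_{\mathrm{ref}}$. Accuracy: for a prompt $\mathbf{x}$ and a distribution $\mathcal{D}$ over unordered output pairs, $$\mathrm{acc}_{\mathbf{x},\mathcal{D}}(r_{\mathrm{RM}})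 := \mathbb{E}_{\{\mathbf{y},\mathbf{y}'\}\sim\mathcal{D}}\Big[\mathbf{1}\big[\mathrm{sign}(r_{\mathrm{RM}}(\mathbf{x},\mathbf{y})-r_{\mathrm{RM}}(\mathbf{x},\mathbf{y}')) = \mathrm{sign}(r_{\mathrm{G}}(\mathbf{x},\mathbf{y})-r_{\mathrm{G}}(\mathbf{x},\mathbf{y}'))\big]\Big],$$ where $\mathbf{1}[\cdot]$ is the indicator and $\mathrm{sign}(u)=1$ if $u>0$, $0$ if $u=0$, $-1$ otherwise. Attainable accuracy: given $\mathbf{x}$, $\mathcal{D}$, $r_{\mathrm{G}}$, a value $\alpha\in[0,1]$ is an attainable accuracy if there exists $r_{\mathrm{RM}}:\mathcal{X}\times\mathcal{Y}\to[-1,1]$ with $\mathrm{acc}_{\mathbf{x},\mathcal{D}}(r_{\mathrm{RM}})=\alpha$. For $\mathbf{y}\in\mathcal{Y}$, $\alpha$ is an attainable accuracy subject to $\mathbf{y}$ being ranked first if there exists $r_{\mathrm{RM}}:\mathcal{X}\times\mathcal{Y}\to[-1,1]$ with $\mathrm{acc}_{\mathbf{x},\mathcal{D}}(r_{\mathrm{RM}})=\alpha$ and $\mathbf{y}\in\mathrm{argmax}_{\mathbf{y}'\in\mathcal{Y}}\, r_{\mathrm{RM}}(\mathbf{x},\mathbf{y}')$. The $\Omega(\cdot)$ and $O(\cdot)$ expressions merely summarize the explicit bounds.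
   Formalization: ''Attainable subject to y^γ being ranked first'' also requires that every output tied with y^γ for the highest r_RM(x,·) has ground truth reward at least r_G(x,y^γ); with arbitrary ties allowed, the upper bound (2) is false. *)

(* Defs.v *)
(* MathComp / MathComp-Analysis *)
From HB Require Import structures.
From mathcomp Require Import all_boot all_order all_algebra.
From mathcomp Require Import all_classical all_reals all_analysis.

Set Implicit Arguments.
Unset Strict Implicit.
Unset Printing Implicit Defensive.

Import Order.TTheory GRing.Theory Num.Theory numFieldNormedType.Exports.

Local Open Scope classical_set_scope.
Local Open Scope ring_scope.


(* Rows of theta are outputs and columns are prompts, indexed by enum_rank. *)
Definition policy (R : realType) (X Y : finType)
    (theta : 'M[R]_(#|Y|, #|X|)) (x : X) (y : Y) : R :=
  expR (theta (enum_rank y) (enum_rank x)) /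
  \sum_(y' : Y) expR (theta (enum_rank y') (enum_rank x)).

Definition is_distr (R : realType) (T : finType) (p : T -> R) : Prop :=
  (forall a, 0 <= p a) /\ \sum_(a : T) p a = 1.

Definition expect (R : realType) (T : finType) (p f : T -> R) : R :=
  \sum_(a : T) p a * f a.

Definition KL (R : realType) (T : finType) (p q : T -> R) : R :=
  expect p (fun a => ln (p a / q a)).

(* The neutral element 1 plays no role for probability vectors, whose entries
   are at most 1. *)
Definition min_prob (R : realType) (T : finType) (p : T -> R) : R :=
  \big[Order.min/1]_(a : T) p a.

Definition is_reward (R : realType) (X Y : finType) (r : X -> Y -> R) : Prop :=
  forall x y, -1 <= r x y <= 1.

Definition rlhf (R : realType) (X Y : finType) (S : {set X})
    (rRM : X -> Y -> R) (lambda : R) (theta_ref theta : 'M[R]_(#|Y|, #|X|)) : R :=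
  (#|S|%:R)^-1 * \sum_(x in S)
    (expect (policy theta x) (rRM x) -
     lambda * KL (policy theta x) (policy theta_ref x)).

Definition gradient (R : realType) (m n : nat) (f : 'M[R]_(m, n) -> R)
    (A : 'M[R]_(m, n)) : 'M[R]_(m, n) :=
  \matrix_(i, j) 'D_(delta_mx i j) f A.

(* Only times t >= 0 are constrained, so the derivative at 0 is one-sided. *)
Definition gradient_flow (R : realType) (m n : nat) (f : 'M[R]_(m, n) -> R)
    (A0 : 'M[R]_(m, n)) (theta : R -> 'M[R]_(m, n)) : Prop :=
  [/\ theta 0 = A0,
      (h^-1 *: (theta h - theta 0) @[h --> 0^'+] --> gradient f (theta 0)) &
      forall t : R, 0 < t -> is_derive t 1 theta (gradient f (theta t))].

(* The first time at which the expected ground truth reward for x has grown by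
   gamma; it is +oo when there is no such time. *)
Definition t_gain (R : realType) (X Y : finType) (rG : X -> Y -> R) (x : X)
    (gamma : R) (theta : R -> 'M[R]_(#|Y|, #|X|)) : \bar R :=
  ereal_inf [set t%:E | t in [set t : R | 0 <= t /\
    expect (policy (theta 0) x) (rG x) + gamma <=
    expect (policy (theta t) x) (rG x)]].

(* Unordered pairs {y, y'}; the degenerate pairs {y, y} are allowed, a
   distribution on pairs of distinct outputs gives them mass 0. *)
Definition upair (Y : finType) : finType := {A : {set Y} | (0 < #|A| <= 2)%N}.

(* The equation between signs is invariant under exchanging y and y', and
   trivial for y = y', so that quantifying over all choices of y and y' in the
   pair tests exactly one equation. *)
Definition agree (R : realType) (X Y : finType) (rG rRM : X -> Y -> R) (x : X)
    (A : upair Y) : bool :=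
  [forall y in val A, forall y' in val A,
    Num.sg (rRM x y - rRM x y') == Num.sg (rG x y - rG x y')].

Lemma agreeE (R : realType) (X Y : finType) (rG rRM : X -> Y -> R) (x : X)
    (A : upair Y) (y y' : Y) : val A = [set y; y']%SET ->
  agree rG rRM x A =
  (Num.sg (rRM x y - rRM x y') == Num.sg (rG x y - rG x y')).
Proof.
move=> AE; apply/idP/idP => [|/eqP e].
  move=> /forall_inP/(_ y); rewrite AE set21 => /(_ isT).
  by move=> /forall_inP/(_ y'); rewrite set22; apply.
apply/forall_inP => a; rewrite AE => /set2P[]->;
  apply/forall_inP => b /set2P[]->; rewrite ?subrr ?e //.
by rewrite -[rRM x y' - _]opprB -[rG x y' - _]opprB !sgrN e.
Qed.

Definition acc (R : realType) (X Y : finType) (rG : X -> Y -> R) (x : X)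
    (D : upair Y -> R) (rRM : X -> Y -> R) : R :=
  expect D (fun A => (agree rG rRM x A)%:R).

Definition attainable (R : realType) (X Y : finType) (rG : X -> Y -> R) (x : X)
    (D : upair Y -> R) (alpha : R) : Prop :=
  0 <= alpha <= 1 /\
  exists rRM : X -> Y -> R, is_reward rRM /\ acc rG x D rRM = alpha.

Definition argmax (R : realType) (Y : finType) (f : Y -> R) : set Y :=
  [set y | forall y', f y' <= f y].

(* Ties for the first rank are allowed, except with an output of strictly lower
   ground truth reward. If D is concentrated on {y, z} with rG x z < rG x y,
   then the accuracy 0 is attained with y in the argmax only by a reward model
   that ties y and z; when Y = {y, z}, no reward model of accuracy 0 makes
   gradient flow (with lambda = 0) increase the probability of y, and the upper
   bound on t_gain fails. *)
Definition attainable_first (R : realType) (X Y : finType) (rG : X -> Y -> R)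
    (x : X) (D : upair Y -> R) (y : Y) (alpha : R) : Prop :=
  0 <= alpha <= 1 /\
  exists rRM : X -> Y -> R,
    [/\ is_reward rRM, acc rG x D rRM = alpha, argmax (rRM x) y &
        forall y', argmax (rRM x) y' -> rG x y <= rG x y'].

(* Main.v *)
Require Import Defs.
From HB Require Import structures.
From mathcomp Require Import all_boot all_order all_algebra.
From mathcomp Require Import all_classical all_reals all_analysis.
From mathcomp Require Import ring lra.
Import Order.TTheory GRing.Theory Num.Theory numFieldNormedType.Exports.
Local Open Scope ring_scope.

(* For the column of [x] write [pi] for the policy, [pi0] for its initial value
   and [g y = r y - lambda * ln (pi y / pi0 y)]; gradient flow reads
   [theta_y' = |S|^-1 * pi y * (g y - E_pi g)].

   Slow model: scale a reward model of accuracy [alpha] by a small [c], which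
   keeps all signs. In the derivative of the squared distance to the initial
   column the KL term contributes minus a variance, so that Gronwall bounds this
   distance by a quantity that is small with [c], uniformly in [lambda].

   Fast model: push a reward model that ranks [yg] first to [1] on the set [A]
   of its maximizers and squeeze it near [-1] elsewhere, keeping the order. As
   all outputs in [A] are at least as good as [yg], the gain is reached once [A]
   has mass [rho]. Among the outputs of [A] follow the initially likeliest one
   rather than [yg] itself: it remains the likeliest, so that its probability
   [p] satisfies [p' >= const * p ^+ 2] as long as [A] has mass below [rho],
   and [1 / p] decreases at least linearly. *)

(** * Derivatives and a Gronwall-type comparison *)

Section derivatives.
Local Open Scope classical_set_scope.
Local Open Scope ring_scope.
Context {R : realType}.
Implicit Types (f g : R -> R) (a b t : R).

Lemma is_derive_sum_fin (I : finType) (P : pred I) (f : R -> I -> R)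
    (df : I -> R) t :
  (forall i, P i -> is_derive t 1 (f^~ i) (df i)) ->
  is_derive t 1 (fun s => \sum_(i | P i) f s i) (\sum_(i | P i) df i).
Proof.
move=> fdf; rewrite (_ : (fun s => _) = \sum_(i | P i) f^~ i); last first.
  by apply/funext => s; rewrite fct_sumE.
by elim/big_ind2 : _ => // [|] *; [exact: is_derive_cst|exact: is_deriveD].
Qed.

Lemma is_derive_mul {f g a b t} : is_derive t 1 f a -> is_derive t 1 g b ->
  is_derive t 1 (fun s => f s * g s) (f t * b + g t * a).
Proof. by move=> fa gb; have := is_deriveM fa gb. Qed.

Lemma is_derive_mulr {f a t} c : is_derive t 1 f a ->
  is_derive t 1 (fun s => f s * c) (a * c).
Proof.
move=> fa; have := is_derive_mul fa (is_derive_cst c t (1 : R)).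
by rewrite mulr0 add0r mulrC.
Qed.

Lemma is_derive_sub {f g a b t} : is_derive t 1 f a -> is_derive t 1 g b ->
  is_derive t 1 (fun s => f s - g s) (a - b).
Proof. by move=> fa gb; have := is_deriveB fa gb. Qed.

Lemma is_derive_inv {f a t} : f t != 0 -> is_derive t 1 f a ->
  is_derive t 1 (fun s => (f s)^-1) (- a / f t ^+ 2).
Proof.
by move=> f0 fa; have := is_deriveV f0 fa; rewrite mulNr mulrC -mulNr.
Qed.

Lemma is_derive_exp {f a t} : is_derive t 1 f a ->
  is_derive t 1 (fun s => expR (f s)) (expR (f t) * a).
Proof. by move=> fa; have := is_derive1_comp (is_derive_expR (f t)) fa. Qed.

Lemma is_derive_log {f a t} : 0 < f t -> is_derive t 1 f a ->
  is_derive t 1 (fun s => ln (f s)) ((f t)^-1 * a).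
Proof. by move=> f0 fa; have := is_derive1_comp (is_derive1_ln f0) fa. Qed.

(** If [f t1 < 0], let [s0] be the last time before [t1] at which [f] is nonnegative. In between [f]
    is negative, hence [f'] nonnegative, and the mean value theorem contradicts
    [f t1 < 0 <= f s0]. *)
Lemma barrier0 f f' a b :
  {within `[a, b], continuous f} ->
  (forall t, t \in `]a, b[ -> is_derive t 1 f (f' t)) ->
  0 <= f a ->
  (forall t, t \in `]a, b[ -> f t < 0 -> 0 <= f' t) ->
  forall t, t \in `[a, b] -> 0 <= f t.
Proof.
move=> fc fd fa0 fneg t1 t1ab; rewrite leNgt; apply/negP => ft1.
have [at1 t1b] : a <= t1 /\ t1 <= b by move: t1ab; rewrite in_itv/= => /andP[].
pose E := [set s | s \in `[a, t1] /\ 0 <= f s].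
have Ea : E a by split=> //; rewrite in_itv/= lexx.
have Eub : ubound E t1 by move=> s [] /[!in_itv]/= /andP[].
have Eb : has_ubound E by exists t1.
have supE : has_sup E by split; first by exists a.
pose s0 := sup E.
have as0 : a <= s0 by exact: (ub_le_sup Eb).
have s0t1 : s0 <= t1 by exact: (ge_sup (ex_intro _ a Ea) Eub).
(* The supremum is attained: otherwise [f] would be negative on a neighbourhood of [s0], which
   contains points of [E]. *)
have fs0 : 0 <= f s0.
  rewrite leNgt; apply/negP => fs0.
  have s0ab : `[a, b]%classic s0 by rewrite /= in_itv/= as0 (le_trans s0t1).
  have := (subspace_continuousP _ _).1 fc s0 s0ab.
  move=> /cvgr_lt /(_ _ fs0); rewrite /= near_withinE => -[e /= e0 Hball].
  have [s [sab fs] ss0] := sup_adherent e0 supE.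
  have ss0' : s <= s0 by apply: (ub_le_sup Eb); split.
  move: sab; rewrite in_itv/= => /andP[as_ st1].
  suff : f s < 0 by rewrite ltNge fs.
  apply: Hball; last by rewrite in_itv/= as_ (le_trans st1).
  by rewrite /= ger0_norm ?subr_ge0// ltrBlDr addrC -ltrBlDr.
have s0lt : s0 < t1.
  by rewrite lt_neqAle s0t1 andbT; apply/eqP => e; move: fs0; rewrite e leNgt ft1.
have sub : `[s0, t1] `<=` `[a, b].
  by move=> z /=; rewrite !in_itv/= => /andP[? ?]; apply/andP; split; lra.
have [c cst cE] : exists2 c, c \in `]s0, t1[ & f t1 - f s0 = f' c * (t1 - s0).
  have fc' : {within `[s0, t1], continuous f} by exact: continuous_subspaceW fc.
  have fd' z : z \in `]s0, t1[ -> is_derive z 1 f (f' z).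
    rewrite in_itv/= => /andP[? ?]; apply: fd; rewrite in_itv/=.
    by apply/andP; split; lra.
  exact: MVT s0lt fd' fc'.
move: cst; rewrite in_itv/= => /andP[s0c ct1].
have cab : c \in `]a, b[ by rewrite in_itv/=; apply/andP; split; lra.
have fc0 : f c < 0.
  rewrite ltNge; apply/negP => fc0.
  have : c <= s0.
    apply: (ub_le_sup Eb); split => //; rewrite in_itv/=.
    by apply/andP; split; lra.
  by rewrite leNgt s0c.
have := fneg c cab fc0; move=> ?; have : 0 <= f' c * (t1 - s0).
  by rewrite mulr_ge0// subr_ge0 ltW.
rewrite -cE; lra.
Qed.

Lemma continuous_exp_lin K (A : set R) :
  {within A, continuous (fun s : R => expR (K * s))}.
Proof.
apply: continuous_subspaceT => s; apply: continuous_comp.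
  exact: mulrl_continuous.
exact: continuous_expR.
Qed.

Lemma is_derive_exp_lin K t :
  is_derive t 1 (fun s : R => expR (K * s)) (expR (K * t) * K).
Proof.
apply: is_derive_exp; have := is_derive_mulr K (is_derive_id t (1 : R)).
by rewrite mul1r; under eq_fun do rewrite mulrC.
Qed.

(* Gronwall's inequality, applied to the negative part of [f]. *)
Lemma barrier f f' a b K :
  {within `[a, b], continuous f} ->
  (forall t, t \in `]a, b[ -> is_derive t 1 f (f' t)) ->
  0 <= f a ->
  (forall t, t \in `]a, b[ -> f t < 0 -> K * f t <= f' t) ->
  forall t, t \in `[a, b] -> 0 <= f t.
Proof.
move=> fc fd fa0 fneg t tab.
have E0 s : 0 < expR (- K * s) by exact: expR_gt0.
rewrite -(pmulr_lge0 _ (E0 t)).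
(* Integrating factor: [g] has the sign of [f] and the derivative
   [expR (- K * s) * (f' s - K * f s)]. *)
pose g s := f s * expR (- K * s); rewrite -/(g t).
apply: (@barrier0 g (fun s => f s * (expR (- K * s) * - K) + expR (- K * s) * f' s)
  a b) => //.
- move=> s; apply: (@cvgM _ (subspace `[a, b])); first exact: fc.
  exact: continuous_exp_lin.
- by move=> s sab; apply: is_derive_mul (fd _ sab) _; exact: is_derive_exp_lin.
- by rewrite mulr_ge0// ltW.
- move=> s sab; rewrite pmulr_llt0// => fs0; have := fneg s sab fs0.
  rewrite -subr_ge0 => h; rewrite mulrA [_ * - K]mulrC mulrA.
  have : 0 <= expR (- K * s) * (f' s - K * f s) by rewrite mulr_ge0// ltW.
  by move/le_trans; apply; rewrite le_eqVlt; apply/orP; left; apply/eqP; ring.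
Qed.

End derivatives.

(** * Softmax policies and the gradient of the RLHF objective *)

Section softmax.
Context {R : realType} {Y : finType}.
Implicit Types (v : Y -> R) (y z : Y) (t lam : R).

Definition softmax v y : R := expR (v y) / \sum_z expR (v z).

Lemma sum_expR_gt0 v y : 0 < \sum_z expR (v z).
Proof.
rewrite (bigD1 y)//=; apply: ltr_pwDl; first exact: expR_gt0.
by apply: sumr_ge0 => z _; exact: expR_ge0.
Qed.

Lemma softmax_gt0 v y : 0 < softmax v y.
Proof. by rewrite divr_gt0 ?expR_gt0// (sum_expR_gt0 v y). Qed.

Lemma softmax_sum1 v (y : Y) : \sum_z softmax v z = 1.
Proof. by rewrite -mulr_suml mulfV// gt_eqF// (sum_expR_gt0 v y). Qed.

Lemma is_derive_softmax (th : R -> Y -> R) (d : Y -> R) t y :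
  (forall z, is_derive t 1 (th^~ z) (d z)) ->
  is_derive t 1 (fun s => softmax (th s) y)
    (softmax (th t) y * (d y - expect (softmax (th t)) d)).
Proof.
move=> thd.
have Z0 := sum_expR_gt0 (th t) y.
have dexp z := is_derive_exp (thd z).
have dZ : is_derive t 1 (fun s => \sum_z expR (th s z))
    (\sum_z expR (th t z) * d z).
  by apply: is_derive_sum_fin => z _; exact: dexp.
have := is_derive_mul (dexp y) (is_derive_inv (lt0r_neq0 Z0) dZ).
move=> /is_derive_eq; apply; rewrite /softmax /expect.
have -> : \sum_a expR (th t a) / (\sum_z expR (th t z)) * d a =
  (\sum_a expR (th t a) * d a) / (\sum_z expR (th t z)).
  by rewrite mulr_suml; apply: eq_bigr => a _; rewrite mulrAC.
by field; exact: lt0r_neq0.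
Qed.

(** Differentiating [p * ln (p / q)] gives [dp * ln (p / q) + dp]; the last terms sum to 0 because
    the total mass is conserved. *)
Lemma is_derive_regularized (p : R -> Y -> R) (dp r q : Y -> R) t lam :
  (forall y, is_derive t 1 (p^~ y) (dp y)) ->
  (forall y, 0 < p t y) -> (forall y, 0 < q y) -> \sum_y dp y = 0 ->
  is_derive t 1 (fun s => expect (p s) r - lam * KL (p s) q)
    (\sum_y dp y * (r y - lam * ln (p t y / q y))).
Proof.
move=> pd p0 q0 dp0.
have dr : is_derive t 1 (fun s => expect (p s) r) (\sum_y dp y * r y).
  by apply: is_derive_sum_fin => y _; exact: is_derive_mulr.
have dK : is_derive t 1 (fun s => KL (p s) q)
    (\sum_y (dp y * ln (p t y / q y) + dp y)).
  apply: is_derive_sum_fin => y _.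
  have dln := @is_derive_log _ (fun s => p s y / q y) _ t
    (divr_gt0 (p0 y) (q0 y)) (is_derive_mulr (q y)^-1 (pd y)).
  have := is_derive_mul (pd y) dln; move=> /is_derive_eq; apply.
  by field; rewrite !lt0r_neq0.
have dlK := is_derive_mulr lam dK.
have := is_derive_sub dr dlK.
rewrite (_ : (fun s => _ - _) =
  (fun s => expect (p s) r - lam * KL (p s) q)); last first.
  by apply/funext => s; rewrite [lam * _]mulrC.
move=> /is_derive_eq; apply.
rewrite big_split/= dp0 addr0 mulr_suml -sumrB; apply: eq_bigr => y _.
by ring.
Qed.

End softmax.

Section gradient.
Context {R : realType} {X Y : finType}.
Implicit Types (S : {set X}) (A : 'M[R]_(#|Y|, #|X|)) (x : X) (y : Y).

Lemma policyE A x : policy A x = softmax (fun y => A (enum_rank y) (enum_rank x)).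
Proof. by []. Qed.

Lemma policy_gt0 A x y : 0 < policy A x y.
Proof. by rewrite policyE softmax_gt0. Qed.

Lemma policy_sum1 A x y : \sum_z policy A x z = 1.
Proof. by rewrite policyE (softmax_sum1 _ y). Qed.

Lemma derive_line (V : normedModType R) (f : V -> R) (A v : V) d :
  is_derive (0 : R) 1 (fun s => f (s *: v + A)) d -> 'D_v f A = d.
Proof.
move=> [_ <-]; rewrite /derive.
rewrite (_ : (fun h => h^-1 *: ((f \o shift A) (h *: v) - f A)) =
  (fun h => h^-1 *: (((fun s : R => f (s *: v + A)) \o shift 0) (h *: 1) -
    f (0 *: v + A)))) //.
by apply/funext => h /=; rewrite scale0r add0r addr0 [h *: 1]mulr1.
Qed.

(** Moving an entry of column [x] changes only the policy at [x], so a single summand of the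
    objective contributes; there the softmax derivative centres the regularized reward. *)
Lemma gradient_rlhf S (r : X -> Y -> R) (lam : R) A0 A x y : x \in S ->
  gradient (rlhf S r lam A0) A (enum_rank y) (enum_rank x) =
  #|S|%:R^-1 * (policy A x y *
    ((r x y - lam * ln (policy A x y / policy A0 x y)) -
     expect (policy A x)
       (fun z => r x z - lam * ln (policy A x z / policy A0 x z)))).
Proof.
move=> xS; rewrite /gradient mxE; apply: derive_line.
set v := delta_mx _ _.
pose d (x' : X) (z : Y) : R := ((z == y) && (x' == x))%:R.
have dent x' z : is_derive (0 : R) 1
    (fun s : R => (s *: v + A) (enum_rank z) (enum_rank x')) (d x' z).
  have := is_derive_sub (is_derive_mulr (d x' z) (is_derive_id (0 : R) 1))
    (is_derive_cst (- A (enum_rank z) (enum_rank x')) (0 : R) 1).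
  rewrite mul1r subr0 => h; rewrite (_ : (fun s => _) =
    (fun s => id s * d x' z - cst (- A (enum_rank z) (enum_rank x')) s))//.
  by apply/funext => s; rewrite !mxE opprK !(inj_eq enum_rank_inj).
have lineE : 0 *: v + A = A by rewrite scale0r add0r.
have dpol x' z : is_derive (0 : R) 1
    (fun s : R => policy (s *: v + A) x' z)
    (policy A x' z * (d x' z - expect (policy A x') (d x'))).
  have := is_derive_softmax _ _ _ z (dent x').
  by rewrite -policyE lineE.
have Ed x' : expect (policy A x') (d x') = if x' == x then policy A x y else 0.
  rewrite /expect; case: (eqVneq x' x) => [->|x'x].
    rewrite (bigD1 y)//= /d !eqxx mulr1 big1 ?addr0// => z /negPf ->.
    by rewrite mulr0.
  by rewrite big1// => z _; rewrite /d (negPf x'x) andbF mulr0.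
have dpol0 x' : \sum_z policy A x' z * (d x' z - expect (policy A x') (d x')) = 0.
  under eq_bigr do rewrite mulrBr.
  by rewrite sumrB -mulr_suml (policy_sum1 _ _ y) mul1r subrr.
have dobj x' := is_derive_regularized _ _ (r x') (policy A0 x') 0 lam (dpol x')
  (policy_gt0 _ x') (policy_gt0 A0 x') (dpol0 x').
have dsum := is_derive_sum_fin X (mem S) _ _ 0 (fun x' _ => dobj x').
have := is_derive_mulr (#|S|%:R^-1) dsum.
rewrite (_ : (fun s => _ * _) = (fun s => rlhf S r lam A0 (s *: v + A))); last first.
  by apply/funext => s; rewrite mulrC.
move=> /is_derive_eq; apply; rewrite mulrC; congr (_ * _).
rewrite (bigD1 x)//= [X in _ + X]big1 ?addr0 => [|x' /andP[_ x'x]]; last first.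
  rewrite big1// => z _; rewrite Ed (negPf x'x) /d (negPf x'x) andbF.
  by rewrite subrr mulr0 mul0r.
rewrite Ed eqxx lineE mulrBr.
set g := fun z => r x z - _.
have -> : policy A x y * (r x y - lam * ln (policy A x y / policy A0 x y)) =
    \sum_z policy A x z * d x z * g z.
  rewrite (bigD1 y)//= /d !eqxx mulr1 big1 ?addr0// => z /negPf ->.
  by rewrite mulr0 mul0r.
rewrite [expect _ g]/expect mulr_sumr -sumrB; apply: eq_bigr => z _.
by rewrite /g; ring.
Qed.

End gradient.

(** * Gradient flow in coordinates *)

Section flow.
Local Open Scope classical_set_scope.
Local Open Scope ring_scope.
Context {R : realType}.

(** At 0 only a one-sided derivative is given: there [theta h] is [theta 0] plus [h] times a
    convergent difference quotient. *)
Lemma gradient_flow_continuous m n (f : 'M[R]_(m, n) -> R) A0 theta i j :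
  gradient_flow f A0 theta ->
  {within `[0, +oo[, continuous (fun t => theta t i j)}.
Proof.
move=> [_ th0 thd]; apply/continuous_within_itvcyP; split.
  move=> t; rewrite in_itv/= andbT => t0.
  apply/differentiable_continuous/derivable1_diffP.
  by move: i j; apply/derivable_mxP; have [] := thd t t0.
have coord (B : 'M[R]_(m, n)) : {for B, continuous (fun C : 'M[R]_(m, n) => C i j)}.
  exact: coord_continuous.
have q : (h^-1 *: (theta h - theta 0)) i j @[h --> 0^'+] -->
    gradient f (theta 0) i j.
  exact: (cvg_comp _ _ th0 (coord _)).
have : theta 0 i j + h * (h^-1 *: (theta h - theta 0)) i j @[h --> 0^'+] -->
    theta 0 i j + 0 * gradient f (theta 0) i j.
  apply: cvgD; first exact: cvg_cst.
  apply: cvgM => //; exact: cvg_at_right_filter.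
rewrite mul0r addr0; apply: cvg_trans.
apply: near_eq_cvg; near=> h.
have h0 : h != 0 by rewrite gt_eqF//; near: h; exact: nbhs_right_gt.
by rewrite !mxE mulrA mulfV// mul1r addrCA subrr addr0.
Unshelve. all: by end_near. Qed.

Lemma gradient_flow_derive m n (f : 'M[R]_(m, n) -> R) A0 theta i j (t : R) :
  gradient_flow f A0 theta -> 0 < t ->
  is_derive t 1 (fun t => theta t i j) (gradient f (theta t) i j).
Proof.
move=> [_ _ /(_ t)] + t0 => /(_ t0)[d dE]; split.
  by move: i j; apply/derivable_mxP.
by rewrite -dE derive_mx// mxE.
Qed.

End flow.

(** * Gradient flow of one column *)

Section column_flow.
Local Open Scope classical_set_scope.
Local Open Scope ring_scope.
Context {R : realType} {Y : finType}.
Implicit Types (v w r : Y -> R) (th : R -> Y -> R) (y z : Y) (t lam k c : R).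

Lemma expect_subr (p f : Y -> R) c : \sum_y p y = 1 ->
  expect p (fun y => f y - c) = expect p f - c.
Proof.
move=> p1; rewrite /expect; under eq_bigr do rewrite mulrBr.
by rewrite sumrB -mulr_suml p1 mul1r.
Qed.

(** Up to a constant independent of [y], the derivative of the objective of one prompt with respect
    to the probability of [y]; [v] is the current column and [w] the reference. *)
Definition regularized lam r w v y := r y - lam * ln (softmax v y / softmax w y).

Definition advantage lam r w v y :=
  regularized lam r w v y - expect (softmax v) (regularized lam r w v).

(** The two log-normalizers do not depend on the output, so centring cancels them and the KL term
    acts linearly on the displacement [v - w]. *)
Lemma advantageE lam r w v y : advantage lam r w v y =
  r y - expect (softmax v) r -
  lam * ((v y - w y) - expect (softmax v) (fun z => v z - w z)).
Proof.
pose c := ln (\sum_z expR (v z)) - ln (\sum_z expR (w z)).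
have E z : regularized lam r w v z = r z - lam * (v z - w z) + lam * c.
  rewrite /regularized /softmax.
  have [Zv Zw] := (sum_expR_gt0 v z, sum_expR_gt0 w z).
  rewrite !ln_div ?posrE ?divr_gt0 ?expR_gt0// !expRK /c; ring.
rewrite /advantage /expect; under eq_bigr do rewrite E mulrDr mulrBr.
rewrite E big_split/= sumrB -mulr_suml (softmax_sum1 v y).
under [X in _ - (_ - X + _)]eq_bigr do rewrite mulrCA.
by rewrite -mulr_sumr; ring.
Qed.

(** Gradient flow as seen by one prompt, with [k] standing for the inverse of [#|S|]; the initial
    column [th 0] is also the KL reference. *)
Definition column_flow k lam r th : Prop :=
  (forall y, {within `[0, +oo[, continuous (th^~ y)}) /\
  (forall t y, 0 < t -> is_derive t 1 (th^~ y)
    (k * (softmax (th t) y * advantage lam r (th 0) (th t) y))).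

Lemma within_continuous_sum (I : Type) (s : seq I) (P : pred I) (A : set R)
    (f : I -> R -> R) :
  (forall i, {within A, continuous (f i)}) ->
  {within A, continuous (fun t => \sum_(i <- s | P i) f i t)}.
Proof.
move=> fc; rewrite (_ : (fun t => _) = \sum_(i <- s | P i) f i); last first.
  by apply/funext => t; rewrite fct_sumE.
elim/big_ind: _ => [|g h gc hc|i _]; last exact: fc.
- exact: cst_continuous.
- by move=> t; apply: (@cvgD _ _ (subspace A)); [exact: gc|exact: hc].
Qed.

Lemma within_continuous_softmax th (A : set R) y :
  (forall z, {within A, continuous (th^~ z)}) ->
  {within A, continuous (fun t => softmax (th t) y)}.
Proof.
move=> thc.
have expc z : {within A, continuous (fun t => expR (th t z))}.
  move=> t; apply: (@continuous_comp (subspace A)); first exact: thc.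
  exact: continuous_expR.
move=> t; apply: (@cvgM _ (subspace A)); first exact: expc.
apply: (@cvgV _ (subspace A)); first by rewrite lt0r_neq0// (sum_expR_gt0 _ y).
exact: (within_continuous_sum _ _ _ _ _ expc).
Qed.

Lemma in_itvoo_gt0 (t T : R) : t \in `]0, T[ -> 0 < t.
Proof. by rewrite in_itv/= => /andP[]. Qed.

(** The sum is a variance: the deviation has mean 0, so the factor [f y] may be replaced by
    [f y - expect p f]. *)
Lemma sum_mul_dev_ge0 (p f : Y -> R) : (forall y, 0 <= p y) ->
  \sum_y p y = 1 -> 0 <= \sum_y p y * (f y * (f y - expect p f)).
Proof.
move=> p0 p1.
have -> : \sum_y p y * (f y * (f y - expect p f)) =
    \sum_y p y * (f y - expect p f) ^+ 2.
  set c := expect p f.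
  have h : \sum_y p y * (f y - c) = 0.
    by have := expect_subr p f c p1; rewrite subrr.
  apply/eqP; rewrite -subr_eq0 -sumrB.
  rewrite (eq_bigr (fun y => c * (p y * (f y - c)))) => [|y _]; last by ring.
  by rewrite -mulr_sumr h mulr0.
by apply: sumr_ge0 => y _; rewrite mulr_ge0// sqr_ge0.
Qed.

Lemma expect_le (p f : Y -> R) c : (forall y, 0 <= p y) ->
  \sum_y p y = 1 -> (forall y, f y <= c) -> expect p f <= c.
Proof.
move=> p0 p1 fc; rewrite -[c]mul1r -p1 mulr_suml.
by apply: ler_sum => y _; exact: ler_wpM2l.
Qed.

Lemma expectN (p f : Y -> R) : expect p (fun y => - f y) = - expect p f.
Proof. by rewrite /expect -sumrN; apply: eq_bigr => y _; rewrite mulrN. Qed.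

(* The KL term only pulls the parameters back: its contribution to the
   derivative of [\sum_y (th t y - th 0 y) ^+ 2] is minus a variance. *)
Lemma column_flow_drift k lam r th c t : 0 <= k -> 0 <= lam -> 0 <= c ->
  (forall y, `|r y| <= c) -> column_flow k lam r th -> 0 <= t ->
  1 + \sum_y (th t y - th 0 y) ^+ 2 <= expR (2 * c * k * t).
Proof.
move=> k0 lam0 c0 rc [thc thd] t0; rewrite -subr_ge0.
pose M s := 1 + \sum_y (th s y - th 0 y) ^+ 2.
pose f s := expR (2 * c * k * s) - M s; rewrite -/(M t) -/(f t).
pose dM s := \sum_y 2 * (th s y - th 0 y) *
  (k * (softmax (th s) y * advantage lam r (th 0) (th s) y)).
pose f' s := expR (2 * c * k * s) * (2 * c * k) - dM s.
have M0 : M 0 = 1.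
  by rewrite /M big1 ?addr0// => y _; rewrite subrr expr0n.
apply: (@barrier _ f f' 0 t (2 * c * k)).
- move=> s; apply: (@cvgB _ _ (subspace `[0, t])).
    exact: continuous_exp_lin.
  apply: (@cvgD _ _ (subspace `[0, t])); first exact: cvg_cst.
  apply: within_continuous_sum => y {}s.
  have dc : {within `[0, t], continuous (fun s => th s y - th 0 y)}.
    move=> u; apply: (@cvgB _ _ (subspace `[0, t])); last exact: cvg_cst.
    apply: continuous_subspaceW (thc y) u => u /=.
    by rewrite !in_itv/= andbT => /andP[].
  by apply: (@cvgM _ (subspace `[0, t])); exact: dc.
- move=> s /in_itvoo_gt0 s0; apply: is_derive_sub; first exact: is_derive_exp_lin.
  have dd y : is_derive s 1 (fun u => (th u y - th 0 y) ^+ 2)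
      (2 * (th s y - th 0 y) *
        (k * (softmax (th s) y * advantage lam r (th 0) (th s) y))).
    have h := is_derive_sub (thd s y s0) (is_derive_cst (th 0 y) s 1).
    have := is_derive_mul h h; rewrite subr0 /cst => /is_derive_eq; apply.
    by ring.
  have := is_deriveD (is_derive_cst (1 : R) s 1)
    (is_derive_sum_fin Y xpredT (fun u y => (th u y - th 0 y) ^+ 2) _ s (fun y _ => dd y)).
  by rewrite add0r.
- by rewrite /f M0 mulr0 expR0 subrr.
- move=> s st _; rewrite /f' /f mulrBr; rewrite [_ * expR _]mulrC lerB//.
  pose p := softmax (th s); pose d y := th s y - th 0 y.
  have p0 y : 0 <= p y by rewrite ltW// softmax_gt0.
  case: (pickP Y) => [y0 _|Y0]; last first.
    by rewrite /dM /M !big_pred0// addr0 mulr1 !mulr_ge0.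
  have p1 : \sum_y p y = 1 by rewrite (softmax_sum1 _ y0).
  (* From [2 * |d| <= 1 + d ^+ 2]; this is where the summand 1 of [M] serves. *)
  have dMle y : `|d y| <= M s / 2.
    have : d y ^+ 2 <= \sum_y d y ^+ 2.
      by rewrite (bigD1 y)//= lerDl sumr_ge0// => z _; rewrite sqr_ge0.
    have : 0 <= (`|d y| - 1) ^+ 2 by rewrite sqr_ge0.
    rewrite -[d y ^+ 2]real_normK ?num_real// /M; nra.
  have Er y : `|r y - expect p r| <= 2 * c.
    have ub : expect p r <= c.
      by apply: expect_le => // z; rewrite (le_trans (ler_norm _)).
    have lb : - c <= expect p r.
      rewrite lerNl -expectN; apply: expect_le => // z.
      by rewrite (le_trans (ler_norm _))// normrN.
    have := rc y; rewrite !ler_norml => /andP[? ?]; apply/andP; split; lra.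
  have -> : dM s = 2 * k * (\sum_y p y * (d y * (r y - expect p r)) -
      lam * \sum_y p y * (d y * (d y - expect p d))).
    rewrite mulr_sumr -sumrB mulr_sumr; apply: eq_bigr => y _.
    by rewrite advantageE -/p -/d -/(d y); ring.
  rewrite (_ : 2 * c * k * M s = 2 * k * (c * M s)); last by ring.
  apply: ler_wpM2l; first by rewrite mulr_ge0.
  rewrite lerBlDr; apply: le_trans (_ : c * M s + 0 <= _); last first.
    by rewrite lerD2l mulr_ge0// sum_mul_dev_ge0.
  rewrite addr0; apply: expect_le => // y.
  rewrite (le_trans (ler_norm _))// normrM.
  rewrite (_ : c * M s = M s / 2 * (2 * c)); last by field.
  exact: ler_pM.
- by rewrite in_itv/= t0 lexx.
Qed.

End column_flow.

(** * Slow growth under small rewards, and bounds on logarithmic terms *)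

Section bounds.
Context {R : realType} {Y : finType}.
Implicit Types (v w r : Y -> R) (th : R -> Y -> R) (y z : Y) (t lam k c L : R).

(** The numerator and the normalization of each probability both change by a factor of at most
    [expR eta]. *)
Lemma expect_softmax_le v w (eta : R) (f : Y -> R) :
  (forall y, `|v y - w y| <= eta) -> (forall y, 0 <= f y) ->
  expect (softmax v) f <= expR (2 * eta) * expect (softmax w) f.
Proof.
move=> vw f0; rewrite /expect mulr_sumr; apply: ler_sum => y _.
rewrite mulrA; apply: ler_wpM2r => //.
have [Zv Zw] := (sum_expR_gt0 v y, sum_expR_gt0 w y).
rewrite ler_pdivrMr// /softmax.
rewrite (_ : expR (2 * eta) = expR eta * expR eta); last first.
  by rewrite -expRD; congr expR; ring.
rewrite [leRHS](_ : _ = expR eta * expR (w y) *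
    (expR eta * (\sum_z expR (v z)) / \sum_z expR (w z))); last first.
  by field; exact: lt0r_neq0.
rewrite -[leLHS]mulr1; apply: ler_pM => //; rewrite ?expR_ge0//.
  rewrite -expRD ler_expR; have := vw y; rewrite ler_norml; lra.
rewrite ler_pdivlMr// mul1r mulr_sumr; apply: ler_sum => z _.
rewrite -expRD ler_expR; have := vw z; rewrite ler_norml; lra.
Qed.

(** The drift bound does not involve [lam], so [c] can be fixed before [lam] and [r]: a small [c]
    keeps the column within [eta] of its start up to time [T]. *)
Lemma slow_gain (rG : Y -> R) (gamma k T : R) :
  (forall y, -1 <= rG y <= 1) -> 0 < gamma -> 0 <= k -> 0 <= T ->
  exists c, [/\ 0 < c, c <= 1 & forall lam r th, 0 <= lam ->
    (forall y, `|r y| <= c) -> column_flow k lam r th ->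
    forall t, 0 <= t <= T ->
    expect (softmax (th t)) rG < expect (softmax (th 0)) rG + gamma].
Proof.
move=> rG1 gamma0 k0 T0.
case: (pickP Y) => [y0 _|Y0]; last first.
  exists 1; split=> // lam r th _ _ _ t _.
  by rewrite /expect !big_pred0// add0r.
(* Makes [expR (2 * eta) = 1 + gamma / 4]; as [rG + 1] has mean at most 2, the gain is at most
   [gamma / 2]. *)
pose eta := ln (1 + gamma / 4) / 2.
have eta0 : 0 < eta by rewrite divr_gt0// ln_gt0//; lra.
have ln0 : 0 < ln (1 + eta ^+ 2) by rewrite ln_gt0// ltrDl exprn_gt0.
have kT0 : 0 <= 2 * k * T by rewrite !mulr_ge0.
(* Ensures [2 * c * k * t <= ln (1 + eta ^+ 2)] up to time [T]; the summand 1 keeps the denominator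
   positive when [k * T] is 0. *)
pose c := Num.min 1 (ln (1 + eta ^+ 2) / (1 + 2 * k * T)).
have c0 : 0 < c by rewrite lt_min ltr01 divr_gt0//; lra.
exists c; split=> //; first by rewrite ge_min lexx.
move=> lam r th lam0 rc flow t /andP[t0 tT].
have drift := column_flow_drift _ _ _ _ _ _ k0 lam0 (ltW c0) rc flow t0.
have le_ln : 2 * c * k * t <= ln (1 + eta ^+ 2).
  apply: (@le_trans _ _ (c * (1 + 2 * k * T))); last first.
    rewrite -ler_pdivlMr; last lra.
    by rewrite ge_min lexx orbT.
  rewrite (_ : 2 * c * k * t = c * (2 * k * t)); last by ring.
  apply: ler_wpM2l; first exact: ltW.
  apply: (@le_trans _ _ (2 * k * T)); last lra.
  by apply: ler_wpM2l => //; rewrite mulr_ge0.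
have dist y : `|th t y - th 0 y| <= eta.
  rewrite -ler_sqr ?nnegrE ?normr_ge0 ?(ltW eta0)// real_normK ?num_real//.
  have : 1 + \sum_y (th t y - th 0 y) ^+ 2 <= 1 + eta ^+ 2.
    rewrite (le_trans drift)// -[leRHS]lnK ?ler_expR// posrE; nra.
  rewrite lerD2l; apply: le_trans.
  by rewrite (bigD1 y)//= lerDl sumr_ge0// => z _; rewrite sqr_ge0.
have shift v : expect (softmax v) (fun y => rG y - (-1)) = expect (softmax v) rG - (-1).
  by rewrite expect_subr// (softmax_sum1 _ y0).
have : expect (softmax (th t)) (fun y => rG y - (-1)) <=
    expR (2 * eta) * expect (softmax (th 0)) (fun y => rG y - (-1)).
  apply: expect_softmax_le => // y; have := rG1 y; lra.
rewrite !shift /eta [2 * _]mulrC divfK// lnK ?posrE; last lra.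
have : expect (softmax (th 0)) rG <= 1.
  apply: expect_le; first by move=> y; rewrite ltW// softmax_gt0.
    exact: (softmax_sum1 _ y0).
  by move=> y; have := rG1 y; lra.
nra.
Qed.

Lemma softmax_le1 v y : softmax v y <= 1.
Proof.
rewrite -(softmax_sum1 v y) (bigD1 y)//= lerDl sumr_ge0// => z _.
by rewrite ltW// softmax_gt0.
Qed.

Lemma ln_leB1 (x : R) : 0 < x -> ln x <= x - 1.
Proof. by move=> x0; have := @le_ln1Dx R (x - 1); rewrite subrKC; apply; lra. Qed.

(** This is [ln z <= z - 1] at [z = (x * expR 1)^-1], multiplied by [x]. *)
Lemma xlnx_ge (x : R) : 0 < x -> - (expR 1)^-1 <= x * ln x.
Proof.
move=> x0; have e0 : 0 < expR 1 :> R by exact: expR_gt0.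
have := ln_leB1 (x * expR 1)^-1; rewrite invr_gt0 mulr_gt0// => /(_ isT).
rewrite lnV ?posrE ?mulr_gt0// lnM ?posrE// expRK => h.
have : x * (- ln x) <= x * (x * expR 1)^-1 by rewrite ler_pM2l//; lra.
by rewrite invfM mulrA mulfV ?lt0r_neq0// mul1r; lra.
Qed.

Lemma ln_softmax_ratio v w y :
  ln (softmax v y / softmax w y) = ln (softmax v y) - ln (softmax w y).
Proof. by rewrite (@ln_div _ (softmax v y) (softmax w y)) ?posrE ?softmax_gt0. Qed.

(** Gibbs' inequality: [ln z <= z - 1] at [z = q / p] gives [p - q <= p * ln (p / q)] for each
    output, and the left sides sum to 0. *)
Lemma KL_softmax_ge0 v w : 0 <= KL (softmax v) (softmax w).
Proof.
case: (pickP Y) => [y0 _|Y0]; last by rewrite /KL /expect big_pred0.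
have <- : \sum_y (softmax v y - softmax w y) = 0.
  by rewrite sumrB !(softmax_sum1 _ y0) subrr.
apply: ler_sum => y _; rewrite ln_softmax_ratio.
have := ln_leB1 _ (divr_gt0 (softmax_gt0 w y) (softmax_gt0 v y)).
rewrite ln_softmax_ratio.
move: (softmax v y) (softmax w y) (softmax_gt0 v y) => p q p0.
move=> h; rewrite -(ler_pM2l p0) in h; have : p * (q / p - 1) = q - p.
  by field; exact: lt0r_neq0.
lra.
Qed.

Lemma ln_ratio_le v w L y : - ln (softmax w y) <= L ->
  ln (softmax v y / softmax w y) <= L.
Proof.
move=> wL; rewrite ln_softmax_ratio; have := ln_le0 (softmax_le1 v y); lra.
Qed.

Lemma mass_ln_ratio_ge v w y :
  - (expR 1)^-1 <= softmax v y * ln (softmax v y / softmax w y).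
Proof.
rewrite ln_softmax_ratio mulrBr lerBrDr.
apply: le_trans (xlnx_ge _ (softmax_gt0 v y)).
by rewrite gerDl mulr_ge0_le0 ?ln_le0 ?softmax_le1// ltW// softmax_gt0.
Qed.

Lemma advantage_split lam r w v y : advantage lam r w v y =
  r y - expect (softmax v) r -
  lam * (ln (softmax v y / softmax w y) - KL (softmax v) (softmax w)).
Proof.
rewrite /advantage /regularized /KL /expect.
under eq_bigr do rewrite mulrBr mulrCA.
by rewrite sumrB -mulr_sumr; ring.
Qed.

End bounds.

(** * Growth of the mass of the top outputs *)

Section top_outputs.
Local Open Scope classical_set_scope.
Local Open Scope ring_scope.
Context {R : realType} {Y : finType}.
Implicit Types (v w r : Y -> R) (th : R -> Y -> R) (y z : Y)
  (t lam k c L eps rho : R) (A : pred Y).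

(** Where the gap [D] is negative, [y] has at least the advantage of [z]: the rewards agree and the
    KL term pulls the gap back to [D 0 >= 0]. What remains of [D'] is [k * (expR D - 1)] times the
    probability and the advantage of [z], hence at least [k * K * D], and [barrier] applies. *)
Lemma ranking_preserved k lam r th L y z t : 0 <= k -> 0 <= lam ->
  column_flow k lam r th -> (forall x, -1 <= r x <= 1) ->
  (forall x, - ln (softmax (th 0) x) <= L) ->
  r y = r z -> th 0 z <= th 0 y -> 0 <= t -> th t z <= th t y.
Proof.
move=> k0 lam0 [thc thd] r1 wL ryz zy0 t0; rewrite -subr_ge0.
pose D s := th s y - th s z; rewrite -/(D t).
pose a s x := advantage lam r (th 0) (th s) x.
pose D' s := k * (softmax (th s) y * a s y) - k * (softmax (th s) z * a s z).
(* Bounds the probability of [z] times its advantage: 2 comes from the rewards, [L] from the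
   divergence and [(expR 1)^-1] from [p * ln (p / q)]. *)
pose K := 2 + lam * (L + (expR 1)^-1).
have L0 : 0 <= L.
  by apply: le_trans (wL y); rewrite oppr_ge0 ln_le0// softmax_le1.
have e0 : 0 < (expR 1)^-1 :> R by rewrite invr_gt0 expR_gt0.
apply: (@barrier _ D D' 0 t (k * K)).
- move=> s; apply: (@cvgB _ _ (subspace `[0, t]));
    apply: continuous_subspaceW (thc _) s => u /=;
    by rewrite !in_itv/= andbT => /andP[].
- move=> s /in_itvoo_gt0 s0; exact: is_derive_sub (thd s y s0) (thd s z s0).
- by rewrite subr_ge0.
- move=> s _ Ds; rewrite /D' -mulrBr -mulrA; apply: ler_wpM2l => //.
  have ayz : 0 <= a s y - a s z.
    rewrite /a !advantageE ryz.
    have : lam * (D s - D 0) <= 0.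
      by rewrite mulr_ge0_le0// subr_le0 (le_trans (ltW Ds))// subr_ge0.
    by rewrite /D; lra.
  have pE : softmax (th s) y = softmax (th s) z * expR (D s).
    rewrite /softmax /D expRB.
    by field; rewrite !lt0r_neq0 ?expR_gt0 ?(sum_expR_gt0 _ y).
  have pz0 := softmax_gt0 (th s) z.
  have pz1 := softmax_le1 (th s) z.
  have aK : softmax (th s) z * a s z <= K.
    rewrite /a advantage_split.
    have r2 : r z - expect (softmax (th s)) r <= 2.
      have : - expect (softmax (th s)) r <= 1.
        rewrite -expectN; apply: expect_le; last by move=> x; have := r1 x; lra.
          by move=> x; rewrite ltW// softmax_gt0.
        exact: (softmax_sum1 _ z).
      have := r1 z; lra.
    have kl : KL (softmax (th s)) (softmax (th 0)) <= L.
      apply: expect_le; last by move=> x; exact: ln_ratio_le.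
        by move=> x; rewrite ltW// softmax_gt0.
      exact: (softmax_sum1 _ z).
    have plnp := mass_ln_ratio_ge (th s) (th 0) z.
    have h1 : softmax (th s) z * (r z - expect (softmax (th s)) r) <= 2.
      apply: le_trans (_ : softmax (th s) z * 2 <= _); first by rewrite ler_pM2l.
      lra.
    have h2 : lam * (softmax (th s) z * KL (softmax (th s)) (softmax (th 0)) -
        softmax (th s) z * ln (softmax (th s) z / softmax (th 0) z)) <=
        lam * (L + (expR 1)^-1).
      apply: ler_wpM2l => //; apply: lerD; last lra.
      have := KL_softmax_ge0 (th s) (th 0); nra.
    rewrite /K; lra.
  have py0 := softmax_gt0 (th s) y.
  have eD : expR (D s) - 1 <= 0.
    by rewrite subr_le0 -expR0 ler_expR ltW.
  have eD1 : D s <= expR (D s) - 1 by have := expR_ge1Dx (D s); lra.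
  have K0 : 0 <= K by rewrite /K addr_ge0// mulr_ge0// addr_ge0// ltW.
  apply: (@le_trans _ _ ((expR (D s) - 1) * (softmax (th s) z * a s z))).
    apply: (@le_trans _ _ ((expR (D s) - 1) * K)).
      by rewrite mulrC ler_wpM2r.
    by rewrite ler_wnM2l.
  have -> : softmax (th s) y * a s y - softmax (th s) z * a s z =
     softmax (th s) y * (a s y - a s z) +
     (softmax (th s) y - softmax (th s) z) * a s z by ring.
  rewrite (_ : (softmax (th s) y - softmax (th s) z) * a s z =
    (expR (D s) - 1) * (softmax (th s) z * a s z)); last by rewrite pE; ring.
  by rewrite lerDr mulr_ge0// ltW.
- by rewrite in_itv/= t0 lexx.
Qed.

End top_outputs.

Section top_drift.
Context {R : realType} {Y : finType}.
Implicit Types (v w r : Y -> R) (th : R -> Y -> R) (y z : Y)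
  (t lam k c L eps rho : R) (A : pred Y).
(** The right-hand side is the reward part of the logarithmic derivative of [p ys], without the
    factor [k]. With [q] the mass of [A], one factor [p y] is bounded by [p ys] on [A] and by
    [1 - q] outside, where [r] exceeds its mean by at most [eps]. The square appears because
    [1 - expect p r >= (2 - eps) * (1 - q)]. *)
Lemma reward_drift A (p r : Y -> R) eps ys : 0 <= eps <= 2 ->
  (forall y, A y -> r y = 1) ->
  (forall y, ~~ A y -> -1 <= r y <= -1 + eps) ->
  (forall y, 0 < p y) -> \sum_y p y = 1 ->
  (forall y, A y -> p y <= p ys) -> A ys ->
  (1 - \sum_(y | A y) p y) ^+ 2 * ((2 - eps) * p ys - eps) <=
  p ys * (r ys - expect p r) - \sum_y p y * (p y * (r y - expect p r)).
Proof.
move=> /andP[eps0 eps2] rA rB p0 p1 pA Ays.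
set q := \sum_(y | A y) p y; set rb := expect p r.
have q' : \sum_(y | ~~ A y) p y = 1 - q.
  by rewrite -p1 [in RHS](bigID A)/= addrAC subrr add0r.
have rbE : rb = q + \sum_(y | ~~ A y) p y * r y.
  rewrite /rb /expect (bigID A)/=; congr (_ + _).
  by apply: eq_bigr => y Ay; rewrite rA// mulr1.
have rb_le : rb <= q + (1 - q) * (-1 + eps).
  rewrite rbE lerD2l -q' mulr_suml; apply: ler_sum => y By.
  by rewrite ler_pM2l//; have /andP[] := rB _ By.
have rb_ge : q - (1 - q) <= rb.
  rewrite rbE lerD2l -q' -sumrN; apply: ler_sum => y By.
  by rewrite -mulrN1 ler_pM2l//; have /andP[] := rB _ By.
have q0 : 0 <= q by apply: sumr_ge0 => y _; exact: ltW.
have q1 : 0 <= 1 - q by rewrite -q' sumr_ge0// => y _; exact: ltW.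
have onA : \sum_(y | A y) p y * (p y * (r y - rb)) <= (1 - rb) * (p ys * q).
  rewrite /q !mulr_sumr; apply: ler_sum => y Ay; rewrite rA//.
  rewrite (_ : p y * (p y * (1 - rb)) = (1 - rb) * (p y * p y)); last by ring.
  have := pA _ Ay; have := p0 y; have : 0 <= 1 - rb by nra.
  by move=> rb1 py pyy; apply: ler_wpM2l => //; apply: ler_wpM2r => //; exact: ltW.
have offA : \sum_(y | ~~ A y) p y * (p y * (r y - rb)) <= (1 - q) * ((1 - q) * eps).
  rewrite -[in leRHS]q' mulr_suml; apply: ler_sum => y By.
  rewrite ler_pM2l//; have /andP[_ rle] := rB _ By.
  have py : p y <= 1 - q.
    by rewrite -q' (bigD1 y)//= lerDl sumr_ge0// => z _; exact: ltW.
  apply: (@le_trans _ _ (p y * eps)); last by rewrite q' ler_wpM2r.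
  by rewrite ler_pM2l//; lra.
rewrite (bigID A)/= rA//.
have h : 0 <= p ys * (1 - q) * (1 - rb - (2 - eps) * (1 - q)).
  by rewrite !mulr_ge0//; [exact: ltW|lra].
rewrite -subr_ge0; move: h onA offA.
set s1 := \sum_(y | A y) _; set s2 := \sum_(y | ~~ A y) _.
nra.
Qed.

(** With [u] the log ratio, [p ys * u ys] and [kl * \sum_y p y * p y] are at most [L], the mean of
    [p * u] is at least [- (expR 1)^-1], and [- p ys * kl] is nonpositive. *)
Lemma KL_drift v w L ys : (forall y, - ln (softmax w y) <= L) ->
  softmax v ys * (ln (softmax v ys / softmax w ys) - KL (softmax v) (softmax w)) -
  \sum_y softmax v y * (softmax v y *
    (ln (softmax v y / softmax w y) - KL (softmax v) (softmax w))) <=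
  (expR 1)^-1 + 2 * L.
Proof.
move=> wL; pose u y := ln (softmax v y / softmax w y).
set kl := KL _ _; rewrite -/(u ys).
under eq_bigr do rewrite -/(u _).
have p0 y : 0 < softmax v y by exact: softmax_gt0.
have p1 := softmax_sum1 v ys; have ple1 y := softmax_le1 v y.
have L0 : 0 <= L.
  by apply: le_trans (wL ys); rewrite oppr_ge0 ln_le0// softmax_le1.
have uL y : u y <= L by exact: ln_ratio_le.
have pu y : - (expR 1)^-1 <= softmax v y * u y by exact: mass_ln_ratio_ge.
have kl0 : 0 <= kl := KL_softmax_ge0 v w.
have klL : kl <= L by apply: expect_le => // y; exact: ltW.
move: (softmax v) p0 p1 ple1 u kl uL pu kl0 klL => p p0 p1 ple1 u kl uL pu kl0 klL.
have -> : \sum_y p y * (p y * (u y - kl)) =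
    \sum_y p y * (p y * u y) - kl * \sum_y p y * p y.
  by rewrite mulr_sumr -sumrB; apply: eq_bigr => y _; ring.
have s1 : - (expR 1)^-1 <= \sum_y p y * (p y * u y).
  rewrite lerNl -[\sum_y _]/(expect p (fun y => p y * u y)) -expectN.
  by apply: expect_le => // y; [exact: ltW|rewrite lerNl].
have s2 : \sum_y p y * p y <= 1 by apply: expect_le => // y; exact: ltW.
have s3 : 0 <= \sum_y p y * p y.
  by apply: sumr_ge0 => y _; rewrite mulr_ge0// ltW.
have h1 : kl * (\sum_y p y * p y) <= L.
  by rewrite -[leRHS]mulr1; apply: ler_pM.
have h2 : p ys * u ys <= L.
  apply: (@le_trans _ _ (p ys * L)); first by rewrite ler_pM2l.
  by rewrite -[leRHS]mul1r ler_wpM2r.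
have h3 : 0 <= p ys * kl by rewrite mulr_ge0// ltW.
by rewrite mulrBr; lra.
Qed.

Lemma top_drift A lam r w v L eps ys : 0 <= lam -> 0 <= eps <= 2 ->
  (forall y, A y -> r y = 1) ->
  (forall y, ~~ A y -> -1 <= r y <= -1 + eps) ->
  (forall y, - ln (softmax w y) <= L) ->
  (forall y, A y -> softmax v y <= softmax v ys) -> A ys ->
  (1 - \sum_(y | A y) softmax v y) ^+ 2 * ((2 - eps) * softmax v ys - eps) -
    lam * ((expR 1)^-1 + 2 * L) <=
  softmax v ys * advantage lam r w v ys -
    \sum_y softmax v y * (softmax v y * advantage lam r w v y).
Proof.
move=> lam0 eps0 rA rB wL pA Ays.
have := reward_drift A _ r _ _ eps0 rA rB (softmax_gt0 v) (softmax_sum1 v ys) pA Ays.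
have := ler_wpM2l lam0 (KL_drift v w L ys wL); rewrite /=.
rewrite advantage_split.
have -> : \sum_y softmax v y * (softmax v y * advantage lam r w v y) =
  \sum_y softmax v y * (softmax v y * (r y - expect (softmax v) r)) -
  lam * \sum_y softmax v y * (softmax v y *
    (ln (softmax v y / softmax w y) - KL (softmax v) (softmax w))).
  rewrite mulr_sumr -sumrB; apply: eq_bigr => y _.
  by rewrite advantage_split; ring.
lra.
Qed.
End top_drift.

Section reach.
Local Open Scope classical_set_scope.
Local Open Scope ring_scope.
Context {R : realType} {Y : finType}.
Implicit Types (r : Y -> R) (th : R -> Y -> R) (y z : Y)
  (t lam k L rho : R) (A : pred Y).

Lemma ler_softmax (v : Y -> R) y z :
  (softmax v y <= softmax v z) = (v y <= v z).
Proof. by rewrite ler_pM2r ?invr_gt0 ?(sum_expR_gt0 v y)// ler_expR. Qed.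

(* As long as [A] has mass less than [rho], the probability [p] of [ys]
   satisfies [p' >= (3 / 4) * k * (1 - rho) ^+ 2 * p ^+ 2]. *)
Lemma top_mass_reaches A k lam r th L rho (p0 : R) ys :
  0 < k -> 0 <= lam -> column_flow k lam r th ->
  (forall y, A y -> r y = 1) ->
  (forall y, ~~ A y -> -1 <= r y <= -1 + p0 / 2) ->
  (forall y, - ln (softmax (th 0) y) <= L) ->
  A ys -> (forall y, A y -> softmax (th 0) y <= softmax (th 0) ys) ->
  0 < p0 <= softmax (th 0) ys -> p0 < rho < 1 ->
  lam * ((expR 1)^-1 + 2 * L) <= p0 * (1 - rho) ^+ 4 / 4 ->
  exists2 t, 0 <= t <= 4 / (k * (1 - rho) ^+ 4) * (p0^-1 - rho^-1) &
    rho <= \sum_(y | A y) softmax (th t) y.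
Proof.
move=> k0 lam0 flow rA rB wL Ays maxys /andP[p00 p0ys] /andP[p0rho rho1] lamL.
have rho0 : 0 < rho by exact: lt_trans p0rho.
set T := 4 / _ * _.
have T0 : 0 < T.
  rewrite /T mulr_gt0 ?divr_gt0 ?mulr_gt0 ?exprn_gt0 ?subr_gt0//.
  by rewrite ltf_pV2.
(* By contradiction: [A] has mass below [rho] on all of [[0, T]]. *)
apply: contrapT => noreach.
have q_lt t : 0 <= t <= T -> \sum_(y | A y) softmax (th t) y < rho.
  by move=> tT; rewrite ltNge; apply/negP => h; apply: noreach; exists t.
have r1 y : -1 <= r y <= 1.
  case: (boolP (A y)) => [/rA ->|/rB]; first by apply/andP; split; lra.
  by move=> /andP[? ?]; apply/andP; split; lra.
have ord t y : 0 <= t -> A y -> softmax (th t) y <= softmax (th t) ys.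
  move=> t0 Ay; rewrite ler_softmax.
  apply: ranking_preserved (ltW k0) lam0 flow r1 wL _ _ t0; first by rewrite !rA.
  by rewrite -ler_softmax; exact: maxys.
pose p t := softmax (th t) ys.
pose a t y := advantage lam r (th 0) (th t) y.
pose s t := p t * a t ys - \sum_y softmax (th t) y * (softmax (th t) y * a t y).
have p_gt0 t : 0 < p t by exact: softmax_gt0.
have p_lt1 t : p t <= 1 by exact: softmax_le1.
have pq t : p t <= \sum_(y | A y) softmax (th t) y.
  by rewrite (bigD1 ys)//= lerDl sumr_ge0// => y _; rewrite ltW// softmax_gt0.
have [thc thd] := flow.
have pc : {within `[0, T], continuous p}.
  apply: within_continuous_softmax => y; apply: continuous_subspaceW (thc y) => u /=.
  by rewrite !in_itv/= andbT => /andP[].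
have pd t : 0 < t -> is_derive t 1 p (k * (p t * s t)).
  move=> t0; have := is_derive_softmax _ _ _ ys (fun y => thd t y t0).
  move=> /is_derive_eq; apply.
  rewrite /s -/(p t) -/(a t ys).
  have -> : expect (softmax (th t))
      (fun y => k * (softmax (th t) y * advantage lam r (th 0) (th t) y)) =
      k * \sum_y softmax (th t) y * (softmax (th t) y * a t y).
    by rewrite /expect mulr_sumr; apply: eq_bigr => y _; rewrite mulrCA.
  ring.
have p01 : p0 <= 1 by exact: le_trans p0ys (softmax_le1 _ _).
have s_ge t : 0 <= t <= T ->
    (1 - \sum_(y | A y) softmax (th t) y) ^+ 2 * ((2 - p0 / 2) * p t - p0 / 2) -
    p0 * (1 - rho) ^+ 4 / 4 <= s t.
  move=> /andP[t0 tT]; apply: le_trans (top_drift A _ _ _ _ _ _ _ lam0 _ rA rB wL _ Ays).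
  - by rewrite lerD2l lerN2.
  - by apply/andP; split; lra.
  - by move=> y; exact: ord.
have rho2 : 0 < (1 - rho) ^+ 2 <= 1.
  rewrite exprn_gt0 ?subr_gt0//=; apply: exprn_ile1; lra.
have rho4 : (1 - rho) ^+ 4 = (1 - rho) ^+ 2 * (1 - rho) ^+ 2 by rewrite -exprD.
(* [p0 * (3 / 4)] collects [p0 / 2] from the rewards and [p0 / 4] from the KL term; [p0 <= 2 * p t]
   makes the factor of [(1 - q) ^+ 2] nonnegative, so that [q] may be replaced by [rho]. *)
have s_ge' t : 0 <= t <= T -> p0 <= 2 * p t ->
    (1 - rho) ^+ 2 * ((2 - p0 / 2) * p t - p0 * (3 / 4)) <= s t.
  move=> tT pt; apply: le_trans (s_ge t tT); have qrho := q_lt t tT.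
  rewrite rho4; move: rho2 => /andP[r20 r21].
  set q := \sum_(y | A y) _ in qrho *.
  have q2 : (1 - rho) ^+ 2 <= (1 - q) ^+ 2.
    by apply: lerXn2r; rewrite ?nnegrE; lra.
  have c0 : 0 <= (2 - p0 / 2) * p t - p0 / 2 by nra.
  have h1 := ler_wpM2r c0 q2.
  have h2 : p0 * ((1 - rho) ^+ 2 * (1 - rho) ^+ 2) <= p0 * (1 - rho) ^+ 2.
    by rewrite ler_pM2l// -[leRHS]mulr1 ler_pM2l.
  lra.
have p_ge t : 0 <= t <= T -> p0 <= p t.
  move=> tT; rewrite -subr_ge0.
  (* Between [p0 / 2] and [p0] the derivative of [p] is nonnegative. Below [p0 / 2] a crude bound
     [p * s >= - (3 / 4) * p0] suffices, since there [(3 / 2) * (p - p0)] is smaller; hence the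
     constant [3 / 2]. *)
  apply: (@barrier _ (fun t => p t - p0) (fun t => k * (p t * s t) - 0) 0 T (k * (3 / 2))).
  - by move=> u; apply: (@cvgB _ _ (subspace `[0, T])); [exact: pc|exact: cvg_cst].
  - move=> u /in_itvoo_gt0 u0; exact: is_derive_sub (pd u u0) (is_derive_cst p0 u 1).
  - by rewrite subr_ge0.
  - move=> u; rewrite in_itv/= => /andP[/ltW u0 /ltW uT] pu.
    have uT' : 0 <= u <= T by rewrite u0 uT.
    rewrite subr0 -mulrA ler_pM2l//.
    have [pu2|pu2] := lerP p0 (2 * p u).
      apply: (@le_trans _ _ 0); first by rewrite mulr_ge0_le0//; lra.
      rewrite mulr_ge0 ?(ltW (p_gt0 u))//; apply: le_trans (s_ge' u uT' pu2).
      rewrite mulr_ge0//; first by rewrite sqr_ge0.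
      nra.
    have su : - (p0 * (3 / 4)) <= s u.
      apply: le_trans (s_ge u uT'); move: rho2 => /andP[r20 r21].
      set q := \sum_(y | A y) _.
      have q0 : 0 <= q by apply: sumr_ge0 => y _; rewrite ltW// softmax_gt0.
      have qr : q < rho by exact: q_lt.
      have q1 : (1 - q) ^+ 2 <= 1 by apply: exprn_ile1; lra.
      have h1 : (1 - q) ^+ 2 * (p0 / 2) <= p0 / 2.
        by rewrite -[leRHS]mul1r ler_wpM2r//; lra.
      have h2 : p0 * (1 - rho) ^+ 4 <= p0.
        by rewrite -[leRHS]mulr1 ler_pM2l// exprn_ile1//; lra.
      have h3 : 0 <= (1 - q) ^+ 2 * ((2 - p0 / 2) * p u).
        by rewrite mulr_ge0 ?sqr_ge0// mulr_ge0 ?(ltW (p_gt0 u))//; lra.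
      lra.
    have h1 : p u * - (p0 * (3 / 4)) <= p u * s u by rewrite ler_pM2l.
    have h2 : p u * (p0 * (3 / 4)) <= p0 * (3 / 4).
      by rewrite -[leRHS]mul1r ler_wpM2r//; lra.
    lra.
  - by rewrite in_itv.
pose c := k * (1 - rho) ^+ 4 / 4.
have cT : c * T = p0^-1 - rho^-1.
  rewrite /c /T; field; rewrite !lt0r_neq0//=.
  by rewrite subr_gt0.
have TT : 0 <= T <= T by rewrite (ltW T0) lexx.
(* [1 / p] decreases at rate at least [c], which forces [rho <= p T]; yet [p T] is at most the mass
   of [A], assumed below [rho]. *)
have : 0 <= p0^-1 - T * c - (p T)^-1.
  pose g t := p0^-1 - t * c - (p t)^-1; rewrite -/(g T).
  apply: (@barrier0 _ g (fun t => 0 - 1 * c - - (k * (p t * s t)) / p t ^+ 2) 0 T).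
  - move=> u; apply: (@cvgB _ _ (subspace `[0, T])).
      apply: (@cvgB _ _ (subspace `[0, T])); first exact: cvg_cst.
      have tc : {within `[0, T], continuous (fun x => x * c)}.
        by apply: continuous_subspaceT => w; exact: mulrr_continuous.
      exact: tc.
    by apply: (@cvgV _ (subspace `[0, T])); [rewrite lt0r_neq0|exact: pc].
  - move=> u /in_itvoo_gt0 u0; apply: is_derive_sub.
      apply: (is_derive_sub (is_derive_cst p0^-1 u 1)).
      exact: (is_derive_mulr c (is_derive_id u 1)).
    by apply: is_derive_inv; [rewrite lt0r_neq0|exact: pd].
  - by rewrite /g mul0r subr0 subr_ge0 lef_pV2 ?posrE.
  - move=> u; rewrite in_itv/= => /andP[/ltW u0 /ltW uT] _.
    have uT' : 0 <= u <= T by rewrite u0 uT.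
    have pu := p_ge u uT'; have pu0 := p_gt0 u.
    have -> : 0 - 1 * c - - (k * (p u * s u)) / p u ^+ 2 = k * (s u / p u) - c.
      by field; exact: lt0r_neq0.
    rewrite subr_ge0 /c -mulrA ler_pM2l// ler_pdivlMr//.
    have su : (1 - rho) ^+ 2 * ((2 - p0 / 2) * p u - p0 * (3 / 4)) <= s u.
      apply: s_ge' => //; lra.
    apply: le_trans su; rewrite rho4; move: rho2.
    move: ((1 - rho) ^+ 2) (p u) pu pu0 => x q p0q q0 /andP[x0 x1].
    have h2 : p0 * q <= q by rewrite -[leRHS]mul1r ler_pM2r.
    apply: (@le_trans _ _ (x * (q / 4))); last by rewrite ler_pM2l//; lra.
    have -> : x * x / 4 * q = x * (x * (q / 4)) by ring.
    rewrite ler_pM2l// -[leRHS]mul1r ler_wpM2r// divr_ge0//; exact: ltW.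
  - by rewrite in_itv/= lexx ltW.
move=> gT; have : (p T)^-1 <= rho^-1 by lra.
rewrite lef_pV2 ?posrE// leNgt (le_lt_trans (pq T))//.
exact: q_lt.
Qed.
End reach.

(** * Reward models *)

Section rewards.
Context {R : realType} {X Y : finType}.
Implicit Types (rG r : X -> Y -> R) (x : X) (y : Y).

(** The gradient entries of column [x] involve no other column, so this column flows on its own. *)
Lemma column_flow_rlhf (S : {set X}) r (lam : R) A0 theta x : x \in S ->
  gradient_flow (rlhf S r lam A0) A0 theta ->
  column_flow (#|S|%:R^-1) lam (r x)
    (fun t y => theta t (enum_rank y) (enum_rank x)).
Proof.
move=> xS gf; split=> [y|t y t0]; first exact: gradient_flow_continuous gf.
have := gradient_flow_derive _ _ _ _ _ (enum_rank y) (enum_rank x) t gf t0.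
have [th0 _ _] := gf.
by rewrite gradient_rlhf// -th0.
Qed.

Lemma acc_order rG x D r r' :
  (forall y y', Num.sg (r' x y - r' x y') = Num.sg (r x y - r x y')) ->
  acc rG x D r' = acc rG x D r.
Proof.
move=> sgE; rewrite /acc; congr expect; apply/funext => A.
congr (nat_of_bool _)%:R; apply: eq_forallb => y; congr (_ ==> _).
by apply: eq_forallb => y'; rewrite sgE.
Qed.

Lemma acc_scale rG x D r (c : R) : 0 < c ->
  acc rG x D (fun x y => c * r x y) = acc rG x D r.
Proof.
by move=> c0; apply: acc_order => y y'; rewrite -mulrBr sgrM gtr0_sg// mul1r.
Qed.

(** Used with [m] the largest reward, which is sent to 1; below [m] an affine map of slope [eps / 2]
    squeezes [[-1, 1]] into [[-1, -1 + eps]]. *)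
Definition squash (m eps a : R) := if m <= a then 1 else -1 + eps * ((a + 1) / 2).

Lemma squash_range (m eps a : R) : 0 <= eps <= 1 -> -1 <= a <= 1 ->
  -1 <= squash m eps a <= 1.
Proof.
move=> /andP[? ?] /andP[? ?]; rewrite /squash; case: ifP => _; apply/andP; split; nra.
Qed.

Lemma squash_bottom (m eps a : R) : 0 <= eps -> -1 <= a <= 1 -> a < m ->
  -1 <= squash m eps a <= -1 + eps.
Proof.
move=> e0 /andP[a1 a2] am; rewrite /squash [m <= a]leNgt am/=; apply/andP; split; nra.
Qed.

Lemma squash_lt (m eps a b : R) : 0 < eps < 2 -> -1 <= a <= 1 -> b <= m -> a < b ->
  squash m eps a < squash m eps b.
Proof.
move=> /andP[e0 e2] /andP[a1 a2] bm ab; rewrite /squash.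
rewrite [m <= a]leNgt (lt_le_trans ab bm)/=; case: ifP => _; nra.
Qed.

Lemma acc_squash rG x D r (m eps : R) : 0 < eps < 2 -> is_reward r ->
  (forall y, r x y <= m) ->
  acc rG x D (fun x y => squash m eps (r x y)) = acc rG x D r.
Proof.
move=> e r1 rm; apply: acc_order => y y'.
have [lt|gt|->] := ltgtP (r x y) (r x y'); last by rewrite !subrr.
- by rewrite !ltr0_sg ?subr_lt0//; exact: squash_lt.
- by rewrite !gtr0_sg ?subr_gt0//; exact: squash_lt.
Qed.

Lemma expect_ge_mass (p f : Y -> R) (A : pred Y) (m : R) :
  (forall y, 0 <= p y) -> \sum_y p y = 1 -> (forall y, -1 <= f y) ->
  (forall y, A y -> m <= f y) ->
  (m + 1) * (\sum_(y | A y) p y) <= expect p f + 1.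
Proof.
move=> p0 p1 f1 Am.
have -> : expect p f + 1 = \sum_y p y * (f y + 1).
  by under eq_bigr do rewrite mulrDr mulr1; rewrite big_split/= p1.
rewrite [leRHS](bigID A)/= -[leLHS]addr0; apply: lerD.
  rewrite mulrC mulr_suml; apply: ler_sum => y Ay; apply: ler_wpM2l => //.
  by rewrite lerD2r Am.
by apply: sumr_ge0 => y _; rewrite mulr_ge0// -lerBlDr sub0r.
Qed.

End rewards.

Theorem theorem5 (R : realType) (X Y : finType) (S : {set X})
    (rG : X -> Y -> R) (hrG : is_reward rG) (x : X) (hx : x \in S)
    (theta0 : 'M[R]_(#|Y|, #|X|)) (gamma : R) (hgamma : 0 < gamma) (yg : Y)
    (hyg : expect (policy theta0 x) (rG x) + gamma < rG x yg) :
  let rho := (expect (policy theta0 x) (rG x) + gamma + 1) / (rG x yg + 1) in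
  0 < rho < 1 /\
  forall (T : R), 1 <= T ->
  forall (D : upair Y -> R), is_distr D ->
  forall (alpha alpha' : R),
    attainable rG x D alpha -> attainable_first rG x D yg alpha' ->
  exists rRM rRM' : X -> Y -> R,
    [/\ is_reward rRM /\ is_reward rRM',
        acc rG x D rRM = alpha,
        acc rG x D rRM' = alpha',
        (forall (lambda : R), 0 <= lambda ->
         forall (theta : R -> 'M[R]_(#|Y|, #|X|)),
           gradient_flow (rlhf S rRM lambda theta0) theta0 theta ->
           ((2 * #|S|%:R * (1 - expR (- (gamma / 2))) * T)%:E
             <= t_gain rG x gamma theta)%E) &
        (forall (lambda : R), 0 <= lambda ->
           lambda <= policy theta0 x yg * (1 - rho) ^+ 4 /
             (8 * ((2 * expR 1)^-1 - 2 * ln (min_prob (policy theta0 x)))) ->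
         forall (theta : R -> 'M[R]_(#|Y|, #|X|)),
           gradient_flow (rlhf S rRM' lambda theta0) theta0 theta ->
           (t_gain rG x gamma theta <=
             (4 * #|S|%:R / (1 - rho) ^+ 4 *
               ((policy theta0 x yg)^-1 - rho^-1))%:E)%E)].
Proof.
set V0 := expect (policy theta0 x) (rG x) in hyg *; move=> rho.
have rG1 y : -1 <= rG x y by have /andP[] := hrG x y.
have pol0 (A : 'M[R]_(#|Y|, #|X|)) y : 0 <= policy A x y by rewrite ltW// policy_gt0.
have pol1 (A : 'M[R]_(#|Y|, #|X|)) : \sum_y policy A x y = 1 := policy_sum1 A x yg.
pose p0 := policy theta0 x yg; rewrite -/p0.
have p0_gt0 : 0 < p0 by exact: policy_gt0.
have p0_le1 : p0 <= 1 by rewrite /p0 policyE softmax_le1.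
(* The mass bound for the single output [yg]; with [gamma > 0] it yields [p0 < rho]. *)
have V0ge : (rG x yg + 1) * p0 <= V0 + 1.
  have := expect_ge_mass (policy theta0 x) (rG x) (pred1 yg) (rG x yg)
    (pol0 _) (pol1 _) rG1.
  by rewrite big_pred1_eq; apply=> y /eqP ->.
have V0ge1 : 0 <= V0 + 1.
  by apply: le_trans V0ge; rewrite mulr_ge0 ?(ltW p0_gt0)// -lerBlDr sub0r.
have g0 : 0 < rG x yg + 1 by lra.
have rho01 : 0 < rho < 1.
  by rewrite /rho divr_gt0//= ?ltr_pdivrMr ?mul1r//; lra.
have p0rho : p0 < rho by rewrite /rho ltr_pdivlMr// mulrC; lra.
split=> // T T1 D _ alpha alpha' [_ [r [r1 rE]]] [_ [r' [r'1 r'E r'max r'top]]].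
have S0 : 0 < #|S|%:R :> R by rewrite ltr0n card_gt0; apply/set0Pn; exists x.
(* The horizon in [slow_gain] is arbitrary, so the required lower bound itself is taken. *)
pose T' : R := 2 * #|S|%:R * (1 - expR (- (gamma / 2))) * T.
have T'0 : 0 <= T'.
  rewrite /T' !mulr_ge0 ?(ltW S0)//; last lra.
  by rewrite subr_ge0 -[leRHS]expR0 ler_expR; lra.
have kS : 0 < #|S|%:R^-1 :> R by rewrite invr_gt0.
have [c [c0 c1 slow]] := slow_gain (rG x) gamma _ T' (hrG x) hgamma (ltW kS) T'0.
(* The squeezing width [p0 / 2] is the one that [top_mass_reaches] asks for. *)
exists (fun x' y => c * r x' y),
  (fun x' y => squash (r' x yg) (p0 / 2) (r' x' y)).
split.
- split=> x' y.
    have := r1 x' y; move=> /andP[? ?]; apply/andP; split; nra.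
  by apply: squash_range => //; apply/andP; split; lra.
- by rewrite acc_scale.
- by rewrite acc_squash//; apply/andP; split; lra.
- move=> lambda lam0 theta gf; apply/ereal_infP => _ [t [t0 ht] <-].
  rewrite lee_fin leNgt; apply/negP => tT.
  have rc y : `|c * r x y| <= c.
    by rewrite normrM gtr0_norm// -[leRHS]mulr1 ler_pM2l// ler_norml.
  have := slow lambda _ _ lam0 rc (column_flow_rlhf _ _ _ _ _ _ hx gf) t.
  by rewrite t0 (ltW tT) ltNge => /(_ isT)/negP; apply; exact: ht.
- move=> lambda lam0 lamle theta gf.
  have [th0 _ _] := gf.
  pose A := [pred y | r' x yg <= r' x y].
  pose th t y := theta t (enum_rank y) (enum_rank x).
  have thE : softmax (th 0) = policy theta0 x by rewrite /th th0.
  pose L := - ln (min_prob (policy theta0 x)).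
  have min0 : 0 < min_prob (policy theta0 x).
    by apply: lt_bigmin => // y _; exact: policy_gt0.
  have wL y : - ln (softmax (th 0) y) <= L.
    by rewrite thE lerN2 ler_ln ?posrE ?policy_gt0//; exact: bigmin_le.
  have Ayg : A yg by rewrite /= lexx.
  (* As [yg] belongs to [A], the output [ys] starts with probability at least [p0]. *)
  have [ys Ays maxys] : exists2 ys, A ys & forall y, A y ->
      softmax (th 0) y <= softmax (th 0) ys.
    by case: (arg_maxP (softmax (th 0)) Ayg) => ys ? ?; exists ys.
  have L0 : 0 <= L.
    by apply: le_trans (wL ys); rewrite oppr_ge0 ln_le0// softmax_le1.
  have e0 : 0 < expR 1 :> R by exact: expR_gt0.
  (* The denominator in the assumption on [lambda] equals [4 * ((expR 1)^-1 + 4 * L)], and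
     [2 * L <= 4 * L]. *)
  have lamL : lambda * ((expR 1)^-1 + 2 * L) <= p0 * (1 - rho) ^+ 4 / 4.
    have ei0 : 0 < (expR 1)^-1 :> R by rewrite invr_gt0.
    have lamE : (2 * expR 1)^-1 - 2 * ln (min_prob (policy theta0 x)) =
      2^-1 * (expR 1)^-1 + 2 * L by rewrite invfM /L; ring.
    move: lamle; rewrite lamE ler_pdivlMr; last by rewrite mulr_gt0//; lra.
    move=> lamle.
    have : lambda * ((expR 1)^-1 + 2 * L) <= lambda * ((expR 1)^-1 + 4 * L).
      by apply: ler_wpM2l => //; lra.
    lra.
  have [t /andP[t0 tT] qt] : exists2 t : R, 0 <= t <= 4 / (#|S|%:R^-1 * (1 - rho) ^+ 4) *
      (p0^-1 - rho^-1) & rho <= \sum_(y | A y) softmax (th t) y.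
    apply: (top_mass_reaches _ _ _ _ _ _ _ _ _ kS lam0
      (column_flow_rlhf _ _ _ _ _ _ hx gf) _ _ wL Ays maxys _ _ lamL).
    + by move=> y Ay; rewrite /squash ifT.
    + move=> y /=; rewrite -ltNge => Ay; apply: squash_bottom => //.
      by rewrite divr_ge0// ltW.
    + by rewrite p0_gt0 /p0 -thE; exact: maxys.
    + by rewrite p0rho; case/andP: rho01.
  have tle : t <= 4 * #|S|%:R / (1 - rho) ^+ 4 * (p0^-1 - rho^-1).
    by move: tT; rewrite [(_^-1 * _)^-1]invfM invrK mulrA.
  rewrite /t_gain; apply: ge_ereal_inf; exists t%:E; last by rewrite lee_fin.
  exists t => //; split=> //.
  rewrite th0 -/V0.
  (* Since [(rG x yg + 1) * rho = V0 + gamma + 1], mass [rho] on outputs at least as good as [yg]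
     achieves the gain. *)
  have := expect_ge_mass (policy (theta t) x) (rG x) A (rG x yg) (pol0 _) (pol1 _) rG1.
  (* Outputs of [A] tie with [yg] for the first rank, so the condition on ties in [attainable_first]
     applies to them. *)
  have topA y : A y -> rG x yg <= rG x y.
    by move=> Ay; apply: r'top => y'; exact: le_trans (r'max y') Ay.
  move=> /(_ topA).
  have : (rG x yg + 1) * rho <= (rG x yg + 1) * \sum_(y | A y) policy (theta t) x y.
    by rewrite ler_pM2l.
  rewrite [_ * rho]mulrC divfK ?lt0r_neq0//; lra.
Qed.
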